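(* Let $H$ be a separable Hilbert space and let $(X,\mu)$ be a $\sigma$-finite positive measure space such that $$0<\eta:=\inf\{\mu(E) : E\subseteq X \text{ measurable},\ 0<\mu(E)<\infty\}.$$ Then every Bessel mapping $F:X\to H$ with respect to $(X,\mu)$ is norm bounded, i.e. there is a constant $C<\infty$ such that $\|F(x)\|\le C$ for all $x\in X$.
   Context: A mapping $F:X\to H$ is weakly measurable if for every $f\in H$ the scalar function $x\mapsto\langle f,F(x)\rangle$ is measurable on $X$. A Bessel mapping with respect to $(X,\mu)$ is a weakly measurable mapping $F:X\to H$ for which there exists a constant $B>0$ with $\int_X|\langle f,F(x)\rangle|^2\,d\mu(x)\le B\|f\|^2$ for all $f\in H$.
   Formalization: The bound ‖F(x)‖ ≤ C is stated for μ-almost every x instead of all x; for all x it fails: take X = ℕ, μ the Dirac mass at 0, H = ℝ, F(n) = n. If the only μ-null set is empty, the bound holds for all x. *)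

(* Defs.v *)
From HB Require Import structures.
From mathcomp Require Import all_boot all_order all_algebra sesquilinear.
From mathcomp Require Import complex.
From mathcomp Require Import all_classical all_reals all_analysis.

Set Implicit Arguments.
Unset Strict Implicit.
Unset Printing Implicit Defensive.

Import Order.TTheory GRing.Theory Num.Theory.
Import numFieldNormedType.Exports.

Local Open Scope classical_set_scope.
Local Open Scope ring_scope.

(* A Hilbert space is taken over either of the two usual scalar fields: the
   real numbers R or the complex numbers R[i]. *)
Variant scalar_kind := RealScalars | ComplexScalars.

Definition scalars (R : realType) (k : scalar_kind) : numFieldType :=
  match k with
  | RealScalars => R
  | ComplexScalars => R[i]
  end.

Definition scalar_conj (R : realType) (k : scalar_kind) :
    scalars R k -> scalars R k :=
  match k with
  | RealScalars => idfun
  | ComplexScalars => @conjc R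
  end.
Arguments scalar_conj : clear implicits.

Definition scalar_re (R : realType) (k : scalar_kind) : scalars R k -> R :=
  match k with
  | RealScalars => idfun
  | ComplexScalars => @complex.Re R
  end.

(* The norm of a normed module over [scalars R k] takes its values in
   [scalars R k] (inside the nonnegative reals); this is the same norm seen as
   a real number. It applies to vectors and, with [V] the scalar field itself,
   to the modulus of scalars. *)
Definition rnorm (R : realType) (k : scalar_kind)
    (V : normedZmodType (scalars R k)) (v : V) : R :=
  scalar_re `|v|.

Definition separable (T : topologicalType) : Prop :=
  exists2 S : set T, countable S & dense S.

(* [{dot H for conj}] is the library's type of inner products: linear in the
   first argument, conjugate-symmetric and positive definite. A Hilbert space
   is a complete normed space whose norm comes from such an inner product. *)
Definition induces_norm (R : realType) (k : scalar_kind)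
    (H : normedModType (scalars R k)) (ip : {dot H for scalar_conj R k}) : Prop :=
  forall f : H, ip f f = `|f| ^+ 2.

(* Borel measurability for functions with values in a scalar field. *)
Definition scalar_measurable (R : realType) (k : scalar_kind)
    (d : measure_display) (X : measurableType d) (g : X -> scalars R k) : Prop :=
  measurable_fun [set: X]
    (g : X -> g_sigma_algebraType (@open (scalars R k))).

Definition weakly_measurable (R : realType) (k : scalar_kind)
    (H : normedModType (scalars R k)) (ip : {dot H for scalar_conj R k})
    (d : measure_display) (X : measurableType d) (F : X -> H) : Prop :=
  forall f : H, scalar_measurable (fun x => ip f (F x)).

(* Changing [F] measurably on a null set preserves this property, so a Bessel
   mapping can only be bounded almost everywhere in general: take the Dirac mass
   at 0 on nat and F n = n. *)
Definition Bessel_mapping (R : realType) (k : scalar_kind)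
    (H : normedModType (scalars R k)) (ip : {dot H for scalar_conj R k})
    (d : measure_display) (X : measurableType d)
    (mu : {measure set X -> \bar R}) (F : X -> H) : Prop :=
  weakly_measurable ip F /\
  exists B : R, 0 < B /\
    forall f : H,
      (\int[mu]_x (rnorm (ip f (F x)) ^+ 2)%:E <= (B * rnorm f ^+ 2)%:E)%E.

(* The infimum is taken in the extended reals, so it is +oo when no measurable
   set has positive finite measure. *)
Definition inf_measure (R : realType) (d : measure_display)
    (X : measurableType d) (mu : {measure set X -> \bar R}) : \bar R :=
  ereal_inf [set mu E | E in
    [set E : set X | measurable E /\ (0 < mu E < +oo)%E]].

(* Main.v *)
Require Import Defs.
From HB Require Import structures.
From mathcomp Require Import all_boot all_order all_algebra sesquilinear.
From mathcomp Require Import complex.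
From mathcomp Require Import all_classical all_reals all_analysis.
From mathcomp Require Import measurable_realfun ring lra.

Set Implicit Arguments.
Unset Strict Implicit.
Unset Printing Implicit Defensive.

Import Order.TTheory GRing.Theory Num.Theory.
Import numFieldNormedType.Exports.
Local Open Scope classical_set_scope.
Local Open Scope ring_scope.

(** Let B be a Bessel bound and let eta be the infimum of the positive finite
    measures. By Markov's inequality the set where |<f, F x>|^2 >= c |f|^2 has
    measure at most B / c for every nonzero f. Once c is so large that
    B < c * eta, this is below eta, so the set is null: there is no measure
    available strictly between 0 and eta. The constant c does not depend on f
    ([Bessel_ae_pairing]).

    A countable union of null sets is null, so for almost every x the inequality
    |<f, F x>| <= sqrt c |f| holds simultaneously for all f in a countable dense
    set ([ae_forall_countable]). Testing it against some f close to v = F x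
    bounds |v| ([dense_pairing_bound]): the polarization identity makes
    |<f, v>| at least |f| |v| / 2 when |f - v| < |v| / 2. The resulting bound is
    2 sqrt c. *)

(** * Real parts and norms over either scalar field *)

Section ScalarReal.
Context {R : realType} {k : scalar_kind}.
Local Notation K := (scalars R k).
Implicit Types z w : K.

Lemma scalar_reD z w : scalar_re (z + w) = scalar_re z + scalar_re w.
Proof. by case: k z w => //= -[? ?] [? ?]. Qed.

Lemma scalar_reN z : scalar_re (- z) = - scalar_re z.
Proof. by case: k z => //= -[? ?]. Qed.

Lemma scalar_re_le z w : z <= w -> scalar_re z <= scalar_re w.
Proof. by case: k z w => //= z w; rewrite lecE => /andP[]. Qed.

Lemma scalar_re_lt z w : z < w -> scalar_re z < scalar_re w.
Proof. by case: k z w => //= z w; rewrite ltcE => /andP[]. Qed.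

(** Nonnegative scalars are real, hence the cross term of the complex product
    vanishes. *)
Lemma scalar_reM z w : 0 <= z -> scalar_re (z * w) = scalar_re z * scalar_re w.
Proof.
case: k z w => //= -[a b] [c d]; rewrite lecE /= => /andP[/eqP -> _] /=.
by rewrite mul0r subr0.
Qed.

Lemma exists_scalar (r : R) : 0 < r -> exists2 e : K, 0 < e & scalar_re e = r.
Proof.
case: k => r0; first by exists r.
by exists r%:C%C => //; rewrite ltcR.
Qed.

Lemma norm_scalar_conj z : `|scalar_conj R k z| = `|z|.
Proof. by case: k z => //= z; exact: normcJ. Qed.

(** The case analysis on the scalar field exposes the conjugation as a
    ring morphism, which [hermC] requires. *)
Lemma form_conj (U : lmodType K) (ip : {dot U for scalar_conj R k}) u v :
  ip u v = scalar_conj R k (ip v u).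
Proof.
by move: U ip u v; case: k => U ip u v; rewrite (hermC ip) expr0 mul1r.
Qed.

End ScalarReal.

Section RealNorm.
Context {R : realType} {k : scalar_kind} {V : normedZmodType (scalars R k)}.
Implicit Types u v : V.

Lemma rnorm_ge0 v : 0 <= rnorm v.
Proof.
have -> : 0 = scalar_re (0 : scalars R k) by case: (k).
exact/scalar_re_le/normr_ge0.
Qed.

Lemma rnorm_gt0 v : v != 0 -> 0 < rnorm v.
Proof.
move=> v0; have -> : 0 = scalar_re (0 : scalars R k) by case: (k).
by apply: scalar_re_lt; rewrite normr_gt0.
Qed.

Lemma rnorm0 : rnorm (0 : V) = 0.
Proof. by rewrite /rnorm normr0; case: (k). Qed.

Lemma ler_rnormD u v : rnorm (u + v) <= rnorm u + rnorm v.
Proof. by rewrite /rnorm -scalar_reD; exact/scalar_re_le/ler_normD. Qed.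

Lemma rnorm_sqr v : scalar_re (`|v| ^+ 2) = rnorm v ^+ 2.
Proof. by rewrite !expr2 scalar_reM. Qed.

End RealNorm.

(** * Measurability of moduli *)

(** The sigma-algebra on scalars is the one generated by the open sets, so this
    is all that measurability of the modulus needs. *)
Lemma open_rnorm_gt (R : realType) (k : scalar_kind) (a : R) :
  open [set z : scalars R k | a < rnorm z].
Proof.
rewrite openE => z /= az; rewrite /interior.
have [e e0 re] : exists2 e : scalars R k, 0 < e & scalar_re e = rnorm z - a.
  by apply: exists_scalar; rewrite subr_gt0.
apply/nbhs_ballP; exists e => //= w; rewrite -ball_normE /= => zw.
have := ler_rnormD w (z - w); rewrite addrC subrK => h.
have : rnorm (z - w) < rnorm z - a by rewrite -re; exact: scalar_re_lt.
lra.
Qed.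

Lemma measurable_rnorm (R : realType) (k : scalar_kind) (d : measure_display)
    (X : measurableType d) (g : X -> scalars R k) :
  scalar_measurable g -> measurable_fun [set: X] (fun x => rnorm (g x)).
Proof.
move=> mg; apply: (measurability _ (RGenOInfty.measurableE R)).
move=> _ [_ [a ->] <-].
have := mg measurableT [set z | a < rnorm z].
rewrite (_ : [set: X] `&` (fun x => rnorm (g x)) @^-1` `]a, +oo[ =
             [set: X] `&` g @^-1` [set z | a < rnorm z]).
  by apply; apply: sub_sigma_algebra; exact: open_rnorm_gt.
by apply/seteqP; split => x /=; rewrite in_itv /= andbT.
Qed.

(** * Recovering the norm from the inner product *)

(** The left-hand side is <f, v> + <v, f>, twice the real part of <f, v>. *)
Lemma polarization_le (R : realType) (k : scalar_kind)
    (H : normedModType (scalars R k)) (ip : {dot H for scalar_conj R k})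
    (ip_norm : induces_norm ip) (f v : H) :
  rnorm f ^+ 2 + rnorm v ^+ 2 - rnorm (f - v) ^+ 2 <= 2 * rnorm (ip f v).
Proof.
have E : `|f| ^+ 2 + `|v| ^+ 2 - `|f - v| ^+ 2 = ip f v + ip v f.
  by rewrite -!ip_norm linearBl !linearBr /=; ring.
rewrite -!rnorm_sqr -scalar_reN -!scalar_reD E.
have Dge0 : ip f v + ip v f <= `|ip f v| + `|ip v f|.
  apply: le_trans (ler_normD _ _); apply: real_ler_norm.
  by rewrite -E rpredB ?rpredD ?rpredX ?normr_real.
apply: le_trans (scalar_re_le Dge0) _.
by rewrite (form_conj ip v f) norm_scalar_conj scalar_reD mulr_natl mulr2n.
Qed.

(** Take f in S with |f - v| < |v| / 2. Polarization gives
    2 |<f, v>| >= |f|^2 + (3/4) |v|^2 >= |f| |v|, while the hypothesis gives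
    |<f, v>| <= sqrt c |f|; then divide by |f|. *)
Lemma dense_pairing_bound (R : realType) (k : scalar_kind)
    (H : normedModType (scalars R k)) (ip : {dot H for scalar_conj R k})
    (ip_norm : induces_norm ip) (S : set H) (c : R) (v : H) :
  dense S -> 0 <= c ->
  (forall f, S f -> rnorm (ip f v) ^+ 2 <= c * rnorm f ^+ 2) ->
  rnorm v <= 2 * Num.sqrt c.
Proof.
move=> dS c0 Sc; have [->|v0] := eqVneq v 0.
  by rewrite rnorm0 mulr_ge0 // sqrtr_ge0.
have [f [vf Sf]] : ball v (`|v| / 2) `&` S !=set0.
  apply: dS; last exact: ball_open.
  by exists v; apply: ballxx; rewrite divr_gt0 // normr_gt0.
have f_near : rnorm (f - v) < rnorm v / 2.
  move: vf; rewrite -ball_normE /= distrC ltr_pdivlMr // mulr_natr => /scalar_re_lt.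
  rewrite mulr2n scalar_reD -!/(rnorm _) => ?; lra.
have nv0 := rnorm_gt0 v0.
(* If f were 0, then |f - v| would be |v|. *)
have nf0 : 0 < rnorm f.
  have := ler_rnormD f (v - f).
  rewrite addrC subrK [rnorm (v - f)]/rnorm distrC -/(rnorm _); lra.
have pol := polarization_le ip_norm f v.
have pair_le : rnorm (ip f v) <= Num.sqrt c * rnorm f.
  rewrite -(ler_pXn2r (n := 2)) ?nnegrE ?rnorm_ge0 ?mulr_ge0 ?sqrtr_ge0 ?rnorm_ge0 //.
  by rewrite exprMn sqr_sqrtr // Sc.
rewrite -(ler_pM2r nf0).
have d0 := rnorm_ge0 (f - v).
have d2 : rnorm (f - v) ^+ 2 <= (rnorm v / 2) ^+ 2.
  by rewrite ler_pXn2r ?nnegrE ?divr_ge0 ?rnorm_ge0 // ltW.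
apply: le_trans (_ : 2 * rnorm (ip f v) <= _); last by rewrite -mulrA ler_pM2l.
apply: le_trans pol; have := sqr_ge0 (rnorm f - rnorm v / 2); nra.
Qed.

(** * Almost everywhere bounds *)

(** The countable index set is transported to the natural numbers by an
    injection; naturals outside its image carry no condition. *)
Lemma ae_forall_countable (R : realType) (d : measure_display)
    (X : measurableType d) (mu : {measure set X -> \bar R}) (T : Type)
    (S : set T) (P : T -> X -> Prop) :
  countable S -> (forall t, S t -> {ae mu, forall x, P t x}) ->
  {ae mu, forall x, forall t, S t -> P t x}.
Proof.
move=> /countable_injP[h h_inj] aeP.
have : {ae mu, forall x, forall n t, S t -> h t = n -> P t x}.
  apply: ae_foralln => n.
  have [[t [St htn]]|no] := pselect (exists t, S t /\ h t = n).
    apply: filterS (aeP t St) => x Ptx s Ss hsn.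
    by rewrite (h_inj s t) ?inE ?hsn ?htn.
  by apply: aeW => x t St htn; case: no; exists t.
by apply: filterS => x Px t St; exact: (Px (h t)).
Qed.

(** By Markov's inequality the superlevel set has measure at most b / a, which is
    less than every positive finite measure of a measurable set. *)
Lemma superlevel_negligible (R : realType) (d : measure_display)
    (X : measurableType d) (mu : {measure set X -> \bar R})
    (g : X -> R) (a b : R) :
  measurable_fun [set: X] g -> (forall x, 0 <= g x) -> 0 < a ->
  (\int[mu]_x (g x)%:E <= b%:E)%E -> (b%:E < a%:E * inf_measure mu)%E ->
  mu.-negligible [set x | a <= g x].
Proof.
move=> mg g0 a0 gb ba.
have mE : measurable [set x | a <= g x].
  rewrite -[X in measurable X]setTI.
  have := mg measurableT `[a, +oo[%classic (measurable_itv _).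
  congr measurable; apply/seteqP; split => x /=; by rewrite in_itv /= andbT.
have markov : (a%:E * mu [set x | (a <= g x)%R] <= b%:E)%E.
  apply: le_trans gb; rewrite -integral_cst //.
  apply: le_trans (_ : \int[mu]_(x in [set x | (a <= g x)%R]) (g x)%:E <= _)%E.
    apply: ge0_le_integral => //=.
    - by move=> x _; rewrite lee_fin ltW.
    - apply/measurable_EFinP; exact: measurable_funS mg.
  apply: ge0_subset_integral => //.
  - exact/measurable_EFinP.
  - by move=> x _; rewrite lee_fin.
have small : (mu [set x | (a <= g x)%R] < inf_measure mu)%E.
  by rewrite -(@lte_pmul2l _ a%:E) ?lte_fin //; exact: le_lt_trans ba.
apply/negligibleP => //; apply/eqP; rewrite eq_le measure_ge0 andbT leNgt.
apply/negP => pos; move: small; rewrite ltNge => /negP; apply.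
apply: ereal_inf_lbound; exists [set x | a <= g x] => //; split=> //.
(* Markov's bound also excludes infinite measure, as [inf_measure] ranges over
   sets of finite measure only. *)
rewrite pos /= ltNge leye_eq; apply/negP => /eqP muy; move: markov.
by rewrite muy mulry gtr0_sg // mul1e.
Qed.

Lemma mule_gt_exists (R : realType) (B : R) (e : \bar R) :
  0 < B -> (0 < e)%E -> exists2 c : R, 0 < c & (B%:E < c%:E * e)%E.
Proof.
move=> B0; case: e => [r||] //; last first.
  by move=> _; exists 1 => //; rewrite mul1e ltry.
rewrite lte_fin => r0; exists (2 * B / r).
  by rewrite divr_gt0 // mulr_gt0.
by rewrite -EFinM lte_fin divfK ?gt_eqF //; lra.
Qed.

(** The quantifier order is the point: c is chosen before f, whereas the null set
    may depend on f. *)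
Lemma Bessel_ae_pairing (R : realType) (k : scalar_kind)
    (H : normedModType (scalars R k)) (ip : {dot H for scalar_conj R k})
    (d : measure_display) (X : measurableType d)
    (mu : {measure set X -> \bar R}) (F : X -> H) :
  (0 < inf_measure mu)%E -> Bessel_mapping ip mu F ->
  exists2 c : R, 0 < c & forall f : H,
    {ae mu, forall x, rnorm (ip f (F x)) ^+ 2 <= c * rnorm f ^+ 2}.
Proof.
move=> eta_gt0 [mF [B [B0 bessel]]].
have [c c0 Bc] := mule_gt_exists B0 eta_gt0.
exists c => // f; have [->|f0] := eqVneq f 0.
  by apply: aeW => x /=; rewrite linear0l !rnorm0 expr0n mulr0.
have nf0 : 0 < rnorm f ^+ 2 by rewrite exprn_gt0 // rnorm_gt0.
apply: (@negligibleS _ _ _ _ [set x | c * rnorm f ^+ 2 <= rnorm (ip f (F x)) ^+ 2]).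
  by move=> x /= /negP; rewrite -ltNge => /ltW.
apply: (superlevel_negligible _ _ _ (bessel f)).
- by apply: measurable_funX; apply: measurable_rnorm; exact: mF.
- by move=> x; exact: sqr_ge0.
- exact: mulr_gt0.
- move: nf0; move: (rnorm f ^+ 2) => a a0.
  by rewrite (mulrC B) (mulrC c) !EFinM -muleA lte_pmul2l ?lte_fin.
Qed.

Unset Implicit Arguments.

Theorem lemma2p3 (R : realType) (k : scalar_kind)
    (H : completeNormedModType (scalars R k))
    (ip : {dot H for scalar_conj R k})
    (ip_norm : induces_norm ip)
    (H_separable : separable H)
    (d : measure_display) (X : measurableType d)
    (mu : {measure set X -> \bar R})
    (mu_sigma_finite : sigma_finite [set: X] mu)
    (eta_gt0 : (0 < inf_measure mu)%E)
    (F : X -> H)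
    (F_Bessel : Bessel_mapping ip mu F) :
  exists C : R, {ae mu, forall x, rnorm (F x) <= C}.
Proof.
have [S S_countable S_dense] := H_separable.
have [c c0 pairing] := Bessel_ae_pairing eta_gt0 F_Bessel.
exists (2 * Num.sqrt c).
have := ae_forall_countable S_countable (fun f _ => pairing f).
apply: filterS => x Sx; exact: (dense_pairing_bound ip_norm S_dense (ltW c0)).
Qed.
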